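(* For every $\mathrm{k}\in\mathbb{N}$, the following problem (EL-k Marking Persistence Problem) is decidable: given a place/transition net $\mathrm{S}=(P,T,F,M_0)$ and a marking $M\in\mathbb{N}^P$, decide whether $M$ is e/l-$\mathrm{k}$-persistent.
   Context: A place/transition net (p/t-net) is $\mathrm{S}=(P,T,F,M_0)$ where $P$ (places) and $T$ (transitions) are finite disjoint sets, $F\subseteq P\times T\cup T\times P$ is the flow relation, and $M_0\in\mathbb{N}^P$ is the initial marking. Markings are vectors in $\mathbb{N}^P$, ordered and added componentwise. For $a\in T$, ${}^\bullet a\in\mathbb{N}^P$ is the vector with $1$ at places $p$ with $(p,a)\in F$ and $0$ elsewhere; $a^\bullet$ is the vector with $1$ at places $p$ with $(a,p)\in F$ and $0$ elsewhere. A transition $a$ is enabled in $M$ (written $Ma$) iff ${}^\bullet a\le M$; then firing $a$ yields $M'=(M-{}^\bullet a)+a^\bullet$ (written $MaM'$). This is extended to strings $w\in T^*$: $M\varepsilon M$, and $MvaM''$ iff $MvM'$ and $M'aM''$ for some $M'$; $Mw$ means $MwM'$ for some $M'$. For $\mathrm{k}\in\mathbb{N}$, a step $Ma$ (with $a$ enabled in $M$) is e/l-$\mathrm{k}$-persistent iff for every $b\in T$, $b\neq a$, $Mb$ implies that there exists $w\in T^*$ with $|w|\le\mathrm{k}$ and $Mawb$. A marking $M$ is e/l-$\mathrm{k}$-persistent iff for every $a\in T$ enabled in $M$ the step $Ma$ is e/l-$\mathrm{k}$-persistent. *)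

(* Defs.v *)
From mathcomp Require Import all_boot.

Set Implicit Arguments.
Unset Strict Implicit.
Unset Printing Implicit Defensive.

(* Decidability is understood in the sense of computability theory, through   *)
(* Kleene's partial recursive functions; the mere existence of a              *)
(* boolean-valued Rocq function would be trivial under classical axioms.      *)

(* recfun n: definitions of n-ary partial recursive functions on nat. *)
Inductive recfun : nat -> Type :=
| RZero n : recfun n
| RSucc : recfun 1
| RProj n (i : 'I_n) : recfun n
| RComp m n (f : recfun m) (g : 'I_m -> recfun n) : recfun n
| RPrim n (f : recfun n) (g : recfun n.+2) : recfun n.+1
| RMin n (f : recfun n.+1) : recfun n.

(* computes f v y: the function defined by f converges at v, with value y.    *)
(* In primitive recursion the recursion variable is the first argument, and   *)
(* the step function receives the counter, the previous value and the         *)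
(* parameters. Minimization requires convergence at all smaller arguments.    *)
Fixpoint computes n (f : recfun n) : n.-tuple nat -> nat -> Prop :=
  match f in recfun n return n.-tuple nat -> nat -> Prop with
  | RZero _ => fun _ y => y = 0
  | RSucc => fun v y => y = (thead v).+1
  | RProj _ i => fun v y => y = tnth v i
  | RComp m _ f g => fun v y =>
      exists2 w : m.-tuple nat,
        forall i, computes (g i) v (tnth w i) & computes f w y
  | RPrim n f g => fun v y =>
      let u : n.-tuple nat := [tuple of behead v] in
      (fix iter_prim x y := match x with
       | 0 => computes f u y
       | x'.+1 => exists2 z, iter_prim x' z &
                             computes g [tuple of x' :: z :: u] y
       end) (thead v) y
  | RMin _ f => fun v y =>
      computes f [tuple of y :: v] 0 /\
      forall i, i < y -> exists z, computes f [tuple of i :: v] z.+1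
  end.

(* Instances x : I of a problem are presented as the natural number coding    *)
(* the sequence enc x; CodeSeq.code (n :: s) = 2 ^ n * (2 * code s + 1).      *)
(* The answers are 1 (yes) and 0 (no).                                        *)
Definition recursively_decidable (I : Type) (enc : I -> seq nat)
    (Q : I -> Prop) : Prop :=
  exists f : recfun 1, forall x : I,
    exists2 b : bool, Q x <-> b &
      computes f [tuple CodeSeq.code (enc x)] (nat_of_bool b).

(* Places and transitions being distinct types, they are disjoint, and        *)
(* P x T \cup T x P is the sum of the two product types.                      *)
Record ptnet := PTNet {
  place : finType;
  transition : finType;
  flow : {set (place * transition) + (transition * place)};
  init : {ffun place -> nat} }.

Notation marking S := {ffun place S -> nat}.

Section Net.
Variable S : ptnet.
Implicit Types (M : marking S) (a b : transition S) (w : seq (transition S)).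

Definition preset a : marking S := [ffun p => nat_of_bool (inl (p, a) \in flow S)].
Definition postset a : marking S := [ffun p => nat_of_bool (inr (a, p) \in flow S)].

Definition enabled M a : Prop := forall p, preset a p <= M p.

Definition fire M a : marking S :=
  [ffun p => (M p - preset a p) + postset a p].

Inductive run M : seq (transition S) -> marking S -> Prop :=
| run_nil : run M [::] M
| run_rcons v a M' : run M v M' -> enabled M' a ->
    run M (rcons v a) (fire M' a).

Definition fireable M w : Prop := exists M', run M w M'.

Definition el_persistent_step (k : nat) M a : Prop :=
  forall b, b != a -> enabled M b ->
  exists2 w, size w <= k & fireable M (a :: rcons w b).

Definition el_persistent (k : nat) M : Prop :=
  forall a, enabled M a -> el_persistent_step k M a.

End Net.

(* A net together with a marking, listed as: number of places, number of      *)
(* transitions, the two incidence matrices of the flow relation row by row    *)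
(* (one row per place), the initial marking and the given marking, with       *)
(* places and transitions taken in the order of their enumerations.           *)
Definition marked_net := {S : ptnet & marking S}.

Definition encode_marked_net (x : marked_net) : seq nat :=
  let S := tag x in
  [:: #|place S|; #|transition S|]
  ++ [seq preset a p | p <- enum (place S), a <- enum (transition S)]
  ++ [seq postset a p | p <- enum (place S), a <- enum (transition S)]
  ++ [seq init S p | p <- enum (place S)]
  ++ [seq tagged x p | p <- enum (place S)].

(* Main.v *)
(* As k is fixed, the quantifier over words w of length at most k unfolds into
   k nested quantifiers over transitions, each bounded by the number of
   transitions; the marking reached after firing them is an explicit arithmetic
   expression in the input and the fired transitions. Persistence is thus a
   formula with bounded quantifiers only, and such formulas over the entries of
   a coded sequence are primitive recursive. *)

Require Import Defs.
From mathcomp Require Import all_boot.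

Set Implicit Arguments.
Unset Strict Implicit.
Unset Printing Implicit Defensive.

(** * Total recursive functions *)

(* The arguments are an environment of size n in de Bruijn style: binders push
   a value at the head. The values of F at lists of other sizes are junk. *)
Definition recursive n (F : seq nat -> nat) : Prop :=
  exists f : recfun n, forall v : n.-tuple nat, computes f v (F v).

Lemma eq_recursive n (F G : seq nat -> nat) :
  (forall v : n.-tuple nat, F v = G v) -> recursive n F -> recursive n G.
Proof. by move=> eFG [f fP]; exists f => v; rewrite -eFG. Qed.

Lemma recursive_comp m n F (G : nat -> seq nat -> nat) :
  recursive m F -> (forall i, i < m -> recursive n (G i)) ->
  recursive n (fun v => F (mkseq (G^~ v) m)).
Proof.
move=> [f fP] recG.
(* Choice over the finite index type turns the separate witnesses into the family that [RComp]
   expects. *)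
have /fin_all_exists[g gP] : forall i : 'I_m, exists g : recfun n,
  forall v, computes g v (G i v) by move=> i; apply: recG.
exists (RComp f g) => v /=; exists [tuple of mkseq (G^~ v) m] => [i|].
  by rewrite (tnth_nth 0) nth_mkseq.
exact: fP.
Qed.

(** * Projections, weakening and substitution of variables *)

Lemma recursive_nth n i : i < n -> recursive n (fun v => nth 0 v i).
Proof.
by move=> lt_in; exists (RProj (Ordinal lt_in)) => v /=; rewrite (tnth_nth 0).
Qed.

Lemma recursive_head n : recursive n.+1 (head 0).
Proof.
by apply: eq_recursive (recursive_nth (ltn0Sn n)) => v; rewrite nth0.
Qed.

Lemma recursive_weaken n F :
  recursive n F -> recursive n.+1 (fun v => F (behead v)).
Proof.
move=> /recursive_comp/(_ (fun i lt_in => @recursive_nth n.+1 i.+1 lt_in)).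
apply: eq_recursive => v; congr F; apply: (@eq_from_nth _ 0).
  by rewrite size_mkseq size_behead size_tuple.
by move=> i; rewrite size_mkseq => lt_in; rewrite nth_mkseq // nth_behead.
Qed.

(** Composition with the projections chosen by [s], which keeps the bound variable at position 0 and
    shifts the others past the variable inserted at position 1. The shape [F (behead v) (head 0 v)]
    treats a family of functions of one bound variable as a single recursive function. *)
Lemma recursive_weaken_under n (F : seq nat -> nat -> nat) :
  recursive n.+1 (fun v => F (behead v) (head 0 v)) ->
  recursive n.+2 (fun v => F (behead (behead v)) (head 0 v)).
Proof.
move=> recF; pose s i := if i is j.+1 then j.+2 else 0.
have lt_s i : i < n.+1 -> s i < n.+2 by case: i.
apply: eq_recursive (recursive_comp recF
  (fun i lt_in => recursive_nth (lt_s i lt_in))) => v.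
congr F; apply: (@eq_from_nth _ 0).
  by rewrite !size_behead size_mkseq size_tuple.
move=> i; rewrite size_behead size_mkseq => lt_in.
by rewrite !nth_behead nth_mkseq.
Qed.

Lemma recursive_subst n (F : seq nat -> nat -> nat) A :
  recursive n.+1 (fun v => F (behead v) (head 0 v)) -> recursive n A ->
  recursive n (fun v => F v (A v)).
Proof.
move=> recF recA; pose G i := if i is j.+1 then nth 0 ^~ j else A.
have recG i : i < n.+1 -> recursive n (G i).
  by case: i => // i lt_in; apply: recursive_nth.
apply: eq_recursive (recursive_comp recF recG) => v.
congr F; apply: (@eq_from_nth _ 0).
  by rewrite size_behead size_mkseq size_tuple.
move=> i; rewrite size_behead size_mkseq => lt_in.
by rewrite nth_behead nth_mkseq.
Qed.

Lemma recursive_nat_rect n A F (G : seq nat -> nat -> nat -> nat) :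
  recursive n A -> recursive n F ->
  recursive n.+2
    (fun v => G (behead (behead v)) (head 0 v) (head 0 (behead v))) ->
  recursive n (fun v => nat_rect (fun=> nat) (F v) (G v) (A v)).
Proof.
move=> recA [f fP] [g gP].
(* [RPrim] recurses on its first argument, so the bound [A v] is first abstracted as a fresh
   variable. *)
apply: (@recursive_subst n (fun v x => nat_rect _ (F v) (G v) x)) recA.
exists (RPrim f g) => v /=.
have -> : head 0 v = thead v by case/tupleP: v.
elim: (thead v) => [|x IHx] /=; first exact: fP.
by eexists; [exact: IHx | exact: gP].
Qed.

(** Primitive recursion whose step, by weakening, ignores the counter. *)
Lemma recursive_iter n A X (F : seq nat -> nat -> nat) :
  recursive n A -> recursive n X ->
  recursive n.+1 (fun v => F (behead v) (head 0 v)) ->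
  recursive n (fun v => iter (A v) (F v) (X v)).
Proof.
move=> recA recX /recursive_weaken recF.
apply: eq_recursive
  (@recursive_nat_rect n A X (fun v _ => F v) recA recX recF) => v.
by elim: (A v) => //= x ->.
Qed.

(** * Arithmetic operations *)

Lemma recursive_succn n A : recursive n A -> recursive n (fun v => (A v).+1).
Proof.
move=> recA; have recS : recursive 1 (fun v => (head 0 v).+1).
  by exists RSucc => v; case/tupleP: v.
exact: recursive_comp recS (fun _ _ => recA).
Qed.

Lemma recursive_const n c : recursive n (fun=> c).
Proof.
elim: c => [|c]; first by exists (RZero n).
exact: recursive_succn.
Qed.

Lemma recursive_addn n A B :
  recursive n A -> recursive n B -> recursive n (fun v => A v + B v).
Proof.
move=> recA recB.
apply: eq_recursive (@recursive_iter n B A (fun=> succn) recB recA _).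
  by move=> v; rewrite iter_succn.
exact: recursive_succn (recursive_head n).
Qed.

Lemma recursive_muln n A B :
  recursive n A -> recursive n B -> recursive n (fun v => A v * B v).
Proof.
move=> recA recB.
apply: eq_recursive (@recursive_iter n B (fun=> 0) (fun v => addn (A v)) recB
  (recursive_const n 0) _).
  by move=> v; rewrite iter_addn_0.
exact: recursive_addn (recursive_weaken recA) (recursive_head n).
Qed.

Lemma recursive_predn n A : recursive n A -> recursive n (fun v => (A v).-1).
Proof.
move=> recA.
apply: eq_recursive (@recursive_nat_rect n A (fun=> 0) (fun _ i _ => i) recA
  (recursive_const n 0) (recursive_head _)).
by move=> v; case: (A v).
Qed.

Lemma recursive_subn n A B :
  recursive n A -> recursive n B -> recursive n (fun v => A v - B v).
Proof.
move=> recA recB.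
apply: eq_recursive (@recursive_iter n B A (fun=> predn) recB recA _).
  by move=> v; rewrite iter_predn.
exact: recursive_predn (recursive_head n).
Qed.

(** Follows from the recurrence [x.+1./2 = x - x./2]. *)
Lemma recursive_half n A : recursive n A -> recursive n (fun v => (A v)./2).
Proof.
move=> recA.
apply: eq_recursive (@recursive_nat_rect n A (fun=> 0) (fun _ => subn) recA
  (recursive_const n 0) _).
  by move=> v; elim: (A v) => //= x ->; rewrite uphalf_half -{1}[x]odd_double_half
    -addnn addnA addnK.
apply: recursive_subn (recursive_head _) (recursive_weaken (recursive_head _)).
Qed.

(** * Connectives, comparisons and bounded quantifiers, with truth values as 0 and 1 *)

Lemma recursive_negb n (A : seq nat -> bool) :
  recursive n A -> recursive n (fun v => ~~ A v).
Proof.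
move=> recA; apply: eq_recursive (recursive_subn (recursive_const n 1) recA).
by move=> v; case: (A v).
Qed.

Lemma recursive_andb n (A B : seq nat -> bool) :
  recursive n A -> recursive n B -> recursive n (fun v => A v && B v).
Proof.
move=> recA recB; apply: eq_recursive (recursive_muln recA recB) => v.
exact: mulnb.
Qed.

Lemma recursive_orb n (A B : seq nat -> bool) :
  recursive n A -> recursive n B -> recursive n (fun v => A v || B v).
Proof.
move=> /recursive_negb recA /recursive_negb recB.
apply: eq_recursive (recursive_negb (recursive_andb recA recB)) => v.
by rewrite negb_and !negbK.
Qed.

Lemma recursive_implyb n (A B : seq nat -> bool) :
  recursive n A -> recursive n B -> recursive n (fun v => A v ==> B v).
Proof.
move=> /recursive_negb recA recB.
by apply: eq_recursive (recursive_orb recA recB) => v; rewrite implybE.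
Qed.

Lemma recursive_odd n A : recursive n A -> recursive n (fun v => odd (A v)).
Proof.
move=> recA.
apply: eq_recursive (@recursive_iter n A (fun=> 0) (fun=> subn 1) recA
  (recursive_const n 0) _).
  by move=> v; elim: (A v) => //= x ->; case: odd.
exact: recursive_subn (recursive_const _ 1) (recursive_head _).
Qed.

Lemma recursive_leq n A B :
  recursive n A -> recursive n B -> recursive n (fun v => A v <= B v).
Proof.
move=> recA recB; apply: eq_recursive
  (recursive_subn (recursive_const n 1) (recursive_subn recA recB)) => v.
by rewrite /leq; case: (A v - B v).
Qed.

Lemma recursive_eqn n A B :
  recursive n A -> recursive n B -> recursive n (fun v => A v == B v).
Proof.
move=> recA recB; apply: eq_recursive
  (recursive_andb (recursive_leq recA recB) (recursive_leq recB recA)) => v.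
by rewrite -eqn_leq.
Qed.

(** A bounded universal quantifier is the product of the truth values of its instances. *)
Lemma recursive_all_iota n A (F : seq nat -> nat -> bool) :
  recursive n A -> recursive n.+1 (fun v => F (behead v) (head 0 v)) ->
  recursive n (fun v => all (F v) (iota 0 (A v))).
Proof.
move=> recA recF.
apply: eq_recursive (@recursive_nat_rect n A (fun=> 1)
  (fun v i r => r * F v i) recA (recursive_const n 1) _).
  move=> v; elim: (A v) => // x IHx.
  by rewrite -{2}[x.+1]addn1 iotaD all_cat /= andbT -mulnb -IHx.
apply: recursive_muln; first exact: recursive_weaken (recursive_head _).
(* The body reads the counter at position 0 and skips the partial product at position 1. *)
exact: (@recursive_weaken_under n (fun v i => F v i)).
Qed.

Lemma recursive_has_iota n A (F : seq nat -> nat -> bool) :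
  recursive n A -> recursive n.+1 (fun v => F (behead v) (head 0 v)) ->
  recursive n (fun v => has (F v) (iota 0 (A v))).
Proof.
move=> recA /recursive_negb recF.
have := recursive_negb (@recursive_all_iota n A (fun v i => ~~ F v i) recA recF).
by apply: eq_recursive => v; rewrite -[in RHS](negbK (has _ _)) -all_predC.
Qed.

(** * Access to the entries of a coded sequence *)

(** The exponent of 2 in [c]: [r] grows as long as [c] halved [r] times is even, then stays. For
    positive [c] the exponent is below [c], so [c] rounds suffice; for [c = 0] the result is 0. *)
Definition code_head c := iter c (fun r => r + ~~ odd (iter r half c)) 0.

(** One halving beyond the exponent also removes the final 1 of [2 * code s + 1]. *)
Definition code_tail c := iter (code_head c).+1 half c.

Definition code_nth c i := code_head (iter i code_tail c).

Lemma iter_half_code n s i : i <= n ->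
  iter i half (CodeSeq.code (n :: s)) = CodeSeq.code (n - i :: s).
Proof.
elim: i => [|i IHi] lt_in; first by rewrite subn0.
rewrite iterS IHi 1?ltnW // subnS; rewrite -subn_gt0 in lt_in.
by case: (n - i) lt_in => //= m _; rewrite expnS -mulnA mul2n doubleK.
Qed.

Lemma code_head_cons n s : code_head (CodeSeq.code (n :: s)) = n.
Proof.
have le_n : n <= CodeSeq.code (n :: s).
  by rewrite ltnW // (leq_trans (ltn_expl n (ltnSn 1))) // leq_pmulr.
rewrite /code_head -[RHS](minn_idPl le_n) minnC.
(* Only the number of rounds varies, the halved code being fixed: after [m] rounds the counter is
   [minn m n]. *)
elim: {1 3}(CodeSeq.code _) => [|m IHm]; first by rewrite min0n.
rewrite iterS IHm iter_half_code ?geq_minr //=.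
have [lt_mn|le_nm] := ltnP m n.
  rewrite (minn_idPl lt_mn); move: lt_mn; rewrite -subn_gt0.
  by case: (n - m) => //= d _; rewrite expnS -mulnA oddM addn1.
by rewrite (minn_idPr (leqW le_nm)) subnn expn0 mul1n /= odd_double addn0.
Qed.

Lemma code_tail_cons n s : code_tail (CodeSeq.code (n :: s)) = CodeSeq.code s.
Proof.
rewrite /code_tail code_head_cons iterS iter_half_code // subnn.
have -> : CodeSeq.code (0 :: s) = (CodeSeq.code s).*2.+1 by apply: mul1n.
exact: uphalf_double.
Qed.

(** No bound on [i] is required: the empty sequence has code 0, which [code_tail] fixes and whose
    head is the default 0. *)
Lemma code_nthE s i : code_nth (CodeSeq.code s) i = nth 0 s i.
Proof.
rewrite /code_nth; elim: s i => [|n s IHs] [|i].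
- by [].
- by rewrite iter_fix.
- exact: code_head_cons.
- by rewrite iterSr code_tail_cons IHs.
Qed.

Lemma recursive_code_head n C :
  recursive n C -> recursive n (fun v => code_head (C v)).
Proof.
move=> recC; apply: (@recursive_iter n C (fun=> 0)
  (fun v r => r + ~~ odd (iter r half (C v)))) => //.
  exact: recursive_const.
apply: recursive_addn; first exact: recursive_head.
apply/recursive_negb/recursive_odd/(@recursive_iter _ _ _ (fun=> half)).
- exact: recursive_head.
- exact: recursive_weaken.
- exact/recursive_half/recursive_head.
Qed.

Lemma recursive_code_tail n C :
  recursive n C -> recursive n (fun v => code_tail (C v)).
Proof.
move=> recC; apply: (@recursive_iter _ _ _ (fun=> half)) => //.
- exact/recursive_succn/recursive_code_head.
- exact/recursive_half/recursive_head.
Qed.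

Lemma recursive_code_nth n C I :
  recursive n C -> recursive n I ->
  recursive n (fun v => code_nth (C v) (I v)).
Proof.
move=> recC recI; apply/recursive_code_head.
apply: (@recursive_iter _ _ _ (fun=> code_tail)) => //.
exact/recursive_code_tail/recursive_head.
Qed.

(** * Persistence as a bounded formula over the code of a net *)

Definition code_places c := code_nth c 0.

Definition code_transitions c := code_nth c 1.

(** The offset 2 skips the two counts; row [p] starts after [p] rows of one entry per transition. *)
Definition code_preset c a p :=
  code_nth c (2 + (p * code_transitions c + a)).

Definition code_postset c a p :=
  code_nth c (2 + (code_places c * code_transitions c
                   + (p * code_transitions c + a))).

Definition code_marking c p :=
  code_nth c (2 + (code_places c * code_transitions c
                   + (code_places c * code_transitions c
                      + (code_places c + p)))).

(** Markings are functions of the place index rather than codes, so that firing is pointwise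
    arithmetic and no new sequence has to be encoded. *)
Definition code_enabled c (m : nat -> nat) a :=
  all (fun p => code_preset c a p <= m p) (iota 0 (code_places c)).

Definition code_fire c (m : nat -> nat) a p :=
  m p - code_preset c a p + code_postset c a p.

(** The first disjunct recurs at every level, which admits words shorter than [k]. *)
Fixpoint code_reach k c m b :=
  code_enabled c m b ||
  if k is k'.+1 then
    has (fun a => code_enabled c m a && code_reach k' c (code_fire c m a) b)
        (iota 0 (code_transitions c))
  else false.

Definition code_persistent k c :=
  all (fun a => code_enabled c (code_marking c) a ==>
    all (fun b => (b != a) ==> code_enabled c (code_marking c) b ==>
                  code_reach k c (code_fire c (code_marking c) a) b)
      (iota 0 (code_transitions c)))
    (iota 0 (code_transitions c)).

(** * Recursiveness of the formula *)

Lemma recursive_code_transitions n C :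
  recursive n C -> recursive n (fun v => code_transitions (C v)).
Proof. by move=> recC; apply: recursive_code_nth (recursive_const _ _). Qed.

Lemma recursive_code_places n C :
  recursive n C -> recursive n (fun v => code_places (C v)).
Proof. by move=> recC; apply: recursive_code_nth (recursive_const _ _). Qed.

Lemma recursive_code_preset n C A P :
  recursive n C -> recursive n A -> recursive n P ->
  recursive n (fun v => code_preset (C v) (A v) (P v)).
Proof.
move=> recC recA recP; have recT := recursive_code_transitions recC.
apply: recursive_code_nth => //; apply: recursive_addn (recursive_const _ _) _.
by apply: recursive_addn => //; apply: recursive_muln.
Qed.

Lemma recursive_code_postset n C A P :
  recursive n C -> recursive n A -> recursive n P ->
  recursive n (fun v => code_postset (C v) (A v) (P v)).
Proof.
move=> recC recA recP; have recT := recursive_code_transitions recC.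
have recN := recursive_code_places recC.
apply: recursive_code_nth => //; apply: recursive_addn (recursive_const _ _) _.
by do !apply: recursive_addn => //; apply: recursive_muln.
Qed.

Lemma recursive_code_marking n C P :
  recursive n C -> recursive n P ->
  recursive n (fun v => code_marking (C v) (P v)).
Proof.
move=> recC recP; have recT := recursive_code_transitions recC.
have recN := recursive_code_places recC.
apply: recursive_code_nth => //; apply: recursive_addn (recursive_const _ _) _.
by do !apply: recursive_addn => //; apply: recursive_muln.
Qed.

Lemma recursive_code_enabled n C (m : seq nat -> nat -> nat) A :
  recursive n C -> recursive n.+1 (fun v => m (behead v) (head 0 v)) ->
  recursive n A -> recursive n (fun v => code_enabled (C v) (m v) (A v)).
Proof.
move=> recC recm recA.
apply: (@recursive_all_iota n (fun v => code_places (C v))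
  (fun v p => code_preset (C v) (A v) p <= m v p)).
  exact: recursive_code_places.
apply: recursive_leq => //; apply: recursive_code_preset (recursive_head _).
  exact: recursive_weaken.
exact: recursive_weaken.
Qed.

Lemma recursive_code_fire n C (m : seq nat -> nat -> nat) A :
  recursive n C -> recursive n.+1 (fun v => m (behead v) (head 0 v)) ->
  recursive n A ->
  recursive n.+1
    (fun v => code_fire (C (behead v)) (m (behead v)) (A (behead v)) (head 0 v)).
Proof.
move=> /recursive_weaken recC recm /recursive_weaken recA.
have recP := recursive_head n.
apply: recursive_addn; last exact: recursive_code_postset.
by apply: recursive_subn => //; apply: recursive_code_preset.
Qed.

(** The induction on [k] must generalize over [n] and [m]: each level binds one more transition and
    replaces the marking by the fired one, which depends on it. *)
Lemma recursive_code_reach k n C (m : seq nat -> nat -> nat) B :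
  recursive n C -> recursive n.+1 (fun v => m (behead v) (head 0 v)) ->
  recursive n B -> recursive n (fun v => code_reach k (C v) (m v) (B v)).
Proof.
elim: k n C m B => [|k IHk] n C m B recC recm recB;
  apply: recursive_orb (recursive_code_enabled recC recm recB) _.
  exact: recursive_const.
apply: (@recursive_has_iota n (fun v => code_transitions (C v))
  (fun v a => code_enabled (C v) (m v) a
              && code_reach k (C v) (code_fire (C v) (m v) a) (B v))).
  exact: recursive_code_transitions.
have recC' := recursive_weaken recC; have recA := recursive_head n.
(* Here the place is at position 0 and the newly bound transition at position 1. *)
have recm' := recursive_weaken_under recm.
apply: recursive_andb.
  exact: (@recursive_code_enabled _ _ (fun v => m (behead v))).
apply: (IHk _ _
  (fun v => code_fire (C (behead v)) (m (behead v)) (head 0 v))) => //.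
  exact: (@recursive_code_fire _ (fun v => C (behead v)) (fun v => m (behead v))).
exact: recursive_weaken.
Qed.

Lemma recursive_code_persistent k n C :
  recursive n C -> recursive n (fun v => code_persistent k (C v)).
Proof.
move=> recC; have recT := recursive_code_transitions recC.
(* Suffix 1 refers to the environment extended by [a], suffix 2 to the one extended by [a] and then
   [b]; [recm1] and [recm2] have a place variable on top. *)
have recC1 := recursive_weaken recC; have recC2 := recursive_weaken recC1.
have recm1 := recursive_code_marking (recursive_weaken recC1) (recursive_head _).
have recm2 := recursive_code_marking (recursive_weaken recC2) (recursive_head _).
have recA1 := recursive_head n; have recA2 := recursive_weaken recA1.
have recB := recursive_head n.+1.
apply: (@recursive_all_iota n _ (fun v a =>
  code_enabled (C v) (code_marking (C v)) a ==> all (fun b =>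
    (b != a) ==> code_enabled (C v) (code_marking (C v)) b ==>
    code_reach k (C v) (code_fire (C v) (code_marking (C v)) a) b)
  (iota 0 (code_transitions (C v))))) => //.
apply: recursive_implyb.
  exact: (@recursive_code_enabled _ _ (fun v => code_marking (C (behead v)))).
apply: (@recursive_all_iota _ _ (fun v b =>
  (b != head 0 v) ==>
  code_enabled (C (behead v)) (code_marking (C (behead v))) b ==>
  code_reach k (C (behead v))
    (code_fire (C (behead v)) (code_marking (C (behead v))) (head 0 v)) b)).
  exact: recursive_weaken recT.
apply: recursive_implyb; first exact/recursive_negb/recursive_eqn.
apply: recursive_implyb.
  exact: (@recursive_code_enabled _ _
    (fun v => code_marking (C (behead (behead v))))).
apply: (@recursive_code_reach _ _ _ (fun v =>
  code_fire (C (behead (behead v))) (code_marking (C (behead (behead v))))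
    (head 0 (behead v)))) => //.
exact: (@recursive_code_fire _ (fun v => C (behead (behead v)))
  (fun v => code_marking (C (behead (behead v)))) (fun v => head 0 (behead v))).
Qed.

(** * Correctness of the formula *)

Lemma nth_allpairs S T R x0 y0 z0 (f : S -> T -> R) s t i j :
  i < size s -> j < size t ->
  nth z0 [seq f x y | x <- s, y <- t] (i * size t + j)
    = f (nth x0 s i) (nth y0 t j).
Proof.
elim: s i => // x s IHs [|i] lt_is lt_jt; rewrite allpairs_cons nth_cat size_map.
  by rewrite lt_jt (nth_map y0).
rewrite mulSn -addnA -ltn_subRL subnn ltn0.
by rewrite addKn IHs.
Qed.

Section Correctness.

Variable S : ptnet.
Implicit Types (M : marking S) (a b : transition S) (w : seq (transition S)).

(** * Runs decomposed at either end of the word *)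

Lemma run_nilP M M' : run M [::] M' <-> M' = M.
Proof.
split=> [run0|->]; last exact: run_nil.
have eqM w : run M w M' -> w = [::] -> M' = M by case=> // -[].
exact: eqM run0 erefl.
Qed.

Lemma run_rconsP M w a M' :
  run M (rcons w a) M' <->
  exists M1, [/\ run M w M1, enabled M1 a & M' = fire M1 a].
Proof.
split=> [run_wa|[M1 [run_w enMa ->]]]; last exact: run_rcons.
have ex u : run M u M' -> u = rcons w a ->
    exists M1, [/\ run M w M1, enabled M1 a & M' = fire M1 a].
  case=> [|v b M1 run_v enMb /rcons_inj[<- <-]]; first by case: w {run_wa}.
  by exists M1.
exact: ex run_wa erefl.
Qed.

(** Runs are built at the last letter, but [code_reach] consumes the first one; induction from the
    right end of [w] converts between the two. *)
Lemma run_consP M a w M' :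
  run M (a :: w) M' <-> enabled M a /\ run (fire M a) w M'.
Proof.
elim/last_ind: w M' => [|w b IHw] M'.
  rewrite -[[:: a]]/(rcons [::] a); split=> [/run_rconsP|].
    by move=> [M1 [/run_nilP-> enMa ->]]; split=> //; apply: run_nil.
  by move=> [enMa /run_nilP->]; apply: run_rcons => //; apply: run_nil.
rewrite -rcons_cons; split=> [/run_rconsP|[enMa /run_rconsP]].
  move=> [M1 [/IHw[enMa run_w] enM1b ->]].
  by split=> //; apply: run_rcons.
by move=> [M1 [run_w enM1b ->]]; apply: run_rcons => //; apply/IHw.
Qed.

Lemma fireable_cons M a w :
  fireable M (a :: w) <-> enabled M a /\ fireable (fire M a) w.
Proof.
split=> [[M' /run_consP[enMa run_w]] | [enMa [M' run_w]]].
  by split=> //; exists M'.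
by exists M'; apply/run_consP.
Qed.

Lemma fireable1 M a : fireable M [:: a] <-> enabled M a.
Proof.
split=> [/fireable_cons[]//|enMa]; apply/fireable_cons; split=> //.
by exists (fire M a); apply: run_nil.
Qed.

(** * Reading the net and the marking back from the code *)

Variable M0 : marking S.
(** [M0] is the marking under test; the initial marking of the net is [init S]. *)
Let c := CodeSeq.code (encode_marked_net (Tagged (fun S => marking S) M0)).

Lemma code_placesE : code_places c = #|place S|.
Proof. by rewrite /code_places code_nthE. Qed.

Lemma code_transitionsE : code_transitions c = #|transition S|.
Proof. by rewrite /code_transitions code_nthE. Qed.

Lemma nth_flow_matrix (f : place S -> transition S -> nat) s p a :
  nth 0 ([seq f q b | q <- enum (place S), b <- enum (transition S)] ++ s)
      (enum_rank p * #|transition S| + enum_rank a) = f p a.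
Proof.
have lt_p := ltn_ord (enum_rank p); have lt_a := ltn_ord (enum_rank a).
rewrite nth_cat size_allpairs -!cardE ifT; last first.
  (* The index lies before the end of row [p], hence inside the matrix and not in [s]. *)
  apply: (@leq_trans ((enum_rank p).+1 * #|transition S|)).
    by rewrite mulSnr ltn_add2l.
  by rewrite leq_mul2r lt_p orbT.
rewrite -{2}(nth_enum_rank p p) -{2}(nth_enum_rank a a).
by rewrite -(@nth_allpairs _ _ _ p a 0 f) -?cardE.
Qed.

Lemma code_presetE p a : code_preset c (enum_rank a) (enum_rank p) = preset a p.
Proof.
by rewrite /code_preset code_nthE code_transitionsE [LHS]/= nth_flow_matrix.
Qed.

Lemma nth_cat_addn (s1 s2 : seq nat) i :
  nth 0 (s1 ++ s2) (size s1 + i) = nth 0 s2 i.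
Proof. by rewrite nth_cat ltnNge leq_addr addKn. Qed.

Lemma code_postsetE p a :
  code_postset c (enum_rank a) (enum_rank p) = postset a p.
Proof.
rewrite /code_postset code_nthE code_transitionsE code_placesE [LHS]/=.
set s := [seq _ | q <- _, b <- _].
have <- : size s = #|place S| * #|transition S|.
  by rewrite size_allpairs -!cardE.
by rewrite nth_cat_addn nth_flow_matrix.
Qed.

Lemma code_markingE p : code_marking c (enum_rank p) = M0 p.
Proof.
rewrite /code_marking code_nthE code_transitionsE code_placesE [LHS]/=.
set s := [seq _ | q <- _, b <- _]; set t := [seq _ | q <- _, b <- _].
have size_s : size s = #|place S| * #|transition S|.
  by rewrite size_allpairs -!cardE.
have size_t : size t = #|place S| * #|transition S|.
  by rewrite size_allpairs -!cardE.
(* Both matrices have the same size: the first product in the offset skips [s], the next one [t]. *)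
rewrite -{1}size_s nth_cat_addn -size_t nth_cat_addn.
have {1}-> : #|place S| = size [seq init S p | p <- enum (place S)].
  by rewrite size_map -cardE.
rewrite nth_cat_addn (nth_map p) ?nth_enum_rank //.
by rewrite -cardE ltn_ord.
Qed.

(** [enum_rank] is a bijection from [T] onto the indices below [#|T|]. *)
Lemma all_iotaP (T : finType) (P : pred nat) :
  reflect (forall x : T, P (enum_rank x)) (all P (iota 0 #|T|)).
Proof.
apply: (iffP allP) => [allP x | allP i].
  by apply: allP; rewrite mem_iota ltn_ord.
rewrite mem_iota => /andP[_ lt_i].
by have := allP (enum_val (Ordinal lt_i)); rewrite enum_valK.
Qed.

Lemma has_iotaP (T : finType) (P : pred nat) :
  reflect (exists x : T, P (enum_rank x)) (has P (iota 0 #|T|)).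
Proof.
apply: (iffP hasP) => [[i] | [x Px]].
  rewrite mem_iota => /andP[_ lt_i] Pi.
  by exists (enum_val (Ordinal lt_i)); rewrite enum_valK.
by exists (enum_rank x : nat); rewrite // mem_iota ltn_ord.
Qed.

(** * Agreement of the formula with the semantics of nets *)

Definition represents (m : nat -> nat) M := forall p, m (enum_rank p) = M p.

Lemma code_enabledP m M a :
  represents m M -> reflect (enabled M a) (code_enabled c m (enum_rank a)).
Proof.
move=> mM; rewrite /code_enabled code_placesE.
by apply: (iffP (all_iotaP _ _)) => en p; have := en p;
  rewrite code_presetE mM.
Qed.

Lemma represents_fire m M a :
  represents m M -> represents (code_fire c m (enum_rank a)) (fire M a).
Proof.
by move=> mM p; rewrite /code_fire mM code_presetE code_postsetE [RHS]ffunE.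
Qed.

(** The first disjunct is the case of the empty word; otherwise the first letter is fired and the
    induction hypothesis applies to the resulting marking, so [m] and [M] vary. *)
Lemma code_reachP k m M b : represents m M ->
  reflect (exists2 w, size w <= k & fireable M (rcons w b))
          (code_reach k c m (enum_rank b)).
Proof.
elim: k m M => [|k IHk] m M mM /=; apply: (iffP orP).
- by case=> // /(code_enabledP _ mM) enMb; exists [::] => //; apply/fireable1.
- by case=> -[] // _ /fireable1/(code_enabledP _ mM); left.
- rewrite code_transitionsE => -[/(code_enabledP _ mM) enMb|].
    by exists [::] => //; apply/fireable1.
  move=> /has_iotaP[a /andP[/(code_enabledP _ mM) enMa]].
  move=> /(IHk _ _ (represents_fire a mM))[w le_wk fire_w].
  by exists (a :: w) => //; apply/fireable_cons.
- case=> -[_ /fireable1/(code_enabledP _ mM)|]; first by left.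
  move=> a w le_wk /fireable_cons[enMa fire_w]; right.
  rewrite code_transitionsE; apply/has_iotaP; exists a.
  apply/andP; split; first exact/(code_enabledP _ mM).
  by apply/(IHk _ _ (represents_fire a mM)); exists w.
Qed.

Lemma code_persistentP k : reflect (el_persistent k M0) (code_persistent k c).
Proof.
have mM := code_markingE.
rewrite /code_persistent code_transitionsE.
apply: (iffP (all_iotaP _ _)) => [persM a enMa b neq_ba enMb | persM a].
  have := persM a; move/(code_enabledP _ mM): (enMa) => -> /all_iotaP/(_ b).
  (* Distinct transitions have distinct indices. *)
  rewrite (inj_eq val_inj) (inj_eq enum_rank_inj) neq_ba /=.
  move/(code_enabledP _ mM): (enMb) => -> /=.
  move=> /(code_reachP _ _ (represents_fire a mM))[w le_wk fire_w].
  by exists w => //; apply/fireable_cons.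
apply/implyP=> /(code_enabledP _ mM) enMa; apply/all_iotaP=> b.
rewrite (inj_eq val_inj) (inj_eq enum_rank_inj).
apply/implyP=> neq_ba; apply/implyP=> /(code_enabledP _ mM) enMb.
apply/(code_reachP _ _ (represents_fire a mM)).
by have [w le_wk /fireable_cons[_ fire_w]] := persM a enMa b neq_ba enMb; exists w.
Qed.

End Correctness.

Theorem theorem4 (k : nat) :
  recursively_decidable encode_marked_net
    (fun x : marked_net => el_persistent k (tagged x)).
Proof.
(* The code is the only argument, so [C] is the projection [head 0] at arity 1; [f] depends on [k]
   alone and serves all instances. *)
have [f fP] := recursive_code_persistent k (recursive_head 0).
exists f => -[S M]; exists (code_persistent k
  (CodeSeq.code (encode_marked_net (Tagged (fun S => marking S) M)))).
  exact: rwP (code_persistentP M k).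
exact: fP.
Qed.
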